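(* Let $D$ be an integral domain such that its integral closure $\overline{D}$ is a semilocal Prüfer domain of finite dimension with $s$ maximal ideals. Suppose that all the residue fields of $D$ (at its maximal ideals) have cardinality at least $s$. Let $\mathcal{F}$ be any collection of local overrings of $D$ such that $\bigcap_{A \in \mathcal{F}} A = D$. Then $\bigcap_{A \in \mathcal{F}} A(t) = D(t)$.
   Context: An overring of $D$ is a ring between $D$ and its quotient field $\mathcal{Q}(D)$. $\overline{D}$ is the integral closure of $D$ in $\mathcal{Q}(D)$. For an indeterminate $t$ over $\mathcal{Q}(D)$ and a domain $A$ with $D\subseteq A\subseteq \mathcal{Q}(D)$, the Nagata ring of $A$ is $A(t) := \{ f/g : f,g \in A[t],\ c(g)=A\}\subseteq \mathcal{Q}(D)(t)$, where $c(g)$ is the ideal of $A$ generated by the coefficients of $g$. ''Local'' (resp. ''semilocal'') means having a unique (resp. finitely many) maximal ideal(s). Standing assumption: all rings have finite Krull dimension. *)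

(* Defs.v *)
From HB Require Import structures.
From mathcomp Require Import all_boot all_order all_algebra.
From mathcomp Require Import boolp classical_sets functions cardinality.
Set Implicit Arguments.
Unset Strict Implicit.
Unset Printing Implicit Defensive.
Import GRing.Theory.
Local Open Scope classical_set_scope.
Local Open Scope ring_scope.

(* The rings considered are subrings of a fixed field, represented by their
   carriers; a domain D enters as its image in {fraction D}. *)

Section SubringsOfAField.
Variable K : fieldType.
Implicit Types (A I J M P : set K) (gs : seq K).

Definition is_subring A : Prop :=
  [/\ A 1, forall x y, A x -> A y -> A (x - y)
    & forall x y, A x -> A y -> A (x * y)].

Definition is_submodule A J : Prop :=
  [/\ J 0, forall x y, J x -> J y -> J (x + y)
    & forall a x, A a -> J x -> J (a * x)].

Definition is_ideal A I : Prop := I `<=` A /\ is_submodule A I.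

Definition prime_ideal A P : Prop :=
  [/\ is_ideal A P, P <> A
    & forall x y, A x -> A y -> P (x * y) -> P x \/ P y].

Definition maximal_ideal A M : Prop :=
  [/\ is_ideal A M, M <> A
    & forall I, is_ideal A I -> M `<=` I -> I <> A -> I = M].

Definition maximal_ideals A : set (set K) := [set M | maximal_ideal A M].

Definition is_local A : Prop := exists! M, maximal_ideal A M.

Definition residue_field A M : set (set K) :=
  [set [set x | M (x - a)] | a in A].

(* Chains P 0 < ... < P m of prime ideals; only P 0, ..., P m matter. *)
Definition finite_krull_dim A : Prop :=
  exists n : nat, forall (m : nat) (P : nat -> set K),
    (forall i, (i <= m)%N -> prime_ideal A (P i)) ->
    (forall i, (i < m)%N -> P i `<` P i.+1) ->
    (m <= n)%N.

Definition ideal_gen A gs : set K :=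
  [set x | exists2 a : nat -> K, (forall i, A (a i))
                               & x = \sum_(i < size gs) a i * gs`_i].

Definition submodule_mul I J : set K :=
  [set x | exists2 s : seq (K * K),
             (forall p, p \in s -> I p.1 /\ J p.2)
           & x = \sum_(p <- s) p.1 * p.2].

Definition invertible A I : Prop :=
  exists2 J, is_submodule A J & submodule_mul I J = A.

Definition is_prufer A : Prop :=
  forall gs, (forall g, g \in gs -> A g) -> ideal_gen A gs <> [set 0] ->
    invertible A (ideal_gen A gs).

Definition poly_over A (f : {poly K}) : Prop := forall i, A f`_i.

Definition content A (g : {poly K}) : set K := ideal_gen A g.

(* A(t) inside K(t); content A g = A forces g != 0 when A is a subring. *)
Definition nagata A : set {fraction {poly K}} :=
  [set h | exists f g : {poly K},
     [/\ poly_over A f, poly_over A g, content A g = A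
       & h = tofrac f / tofrac g]].

End SubringsOfAField.

Section Domain.
Variable D : idomainType.

Definition in_frac : set {fraction D} := range (@tofrac D).

Definition integral_closure : set {fraction D} :=
  [set x | integralOver (@tofrac D) x].

Definition overring (A : set {fraction D}) : Prop :=
  is_subring A /\ in_frac `<=` A.

End Domain.

Arguments in_frac : clear implicits.
Arguments integral_closure : clear implicits.

(* Main.v *)
(* Any [h] in the field of fractions of K[t] can be written as [f / g] with [f] in
   K[t] and [g] in D[t] of unit content; then, for each [A] in [F], [f = h g]
   lies in A(t) and in K[t], hence in A[t] (a variant of the Dedekind-Mertens
   lemma), so that [f] is in D[t].
   To get such a denominator, start from any denominator [q]. As the integral
   closure B of D is Pruefer, a multiple [Q] of [q] lies in B[t] and has a
   coefficient 1. The product of the conjugates of [Q] is a multiple of [Q], lies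
   in D[t] by the theorem on symmetric polynomials, and has unit content because
   each conjugate has a coefficient 1. The conjugates live in the universal
   splitting ring of an integral equation, which is free over D. *)

Require Import Defs.
From HB Require Import structures.
From mathcomp Require Import all_boot all_order all_algebra.
From mathcomp Require Import fingroup perm.
From mathcomp Require Import boolp classical_sets functions cardinality.
From mathcomp.multinomials Require Import mpoly.
Set Implicit Arguments.
Unset Strict Implicit.
Unset Printing Implicit Defensive.
Import GRing.Theory Pdiv.CommonRing Pdiv.RingMonic.
Local Open Scope classical_set_scope.
Local Open Scope card_scope.
Local Open Scope ring_scope.

(** * Cancelling a factor of unit content (Dedekind-Mertens) *)

Section UnitContent.
Variables (T : comNzRingType) (N : T -> Prop).
Hypotheses (N0 : N 0) (NB : forall x y, N x -> N y -> N (x - y)).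
Implicit Types (f g q : {poly T}).

Let stab a := forall x, N x -> N (a * x).

Let ND x y : N x -> N y -> N (x + y).
Proof. by move=> Nx Ny; rewrite -[y]opprK -[- y]sub0r; do 2!apply: NB => //. Qed.

Let stabX a n : stab a -> stab (a ^+ n).
Proof.
by move=> sa x Nx; elim: n => [|n IHn]; rewrite ?mul1r // exprS -mulrA; apply: sa.
Qed.

(** Induction on the length of [f]: [c * f]_n[, with]c = g[_b], is the top coefficient of [f * g],
    so it lies in [N]. Removing the top term of [c *: f] gives a shorter polynomial whose product
    with [g] still has coefficients in [N]. *)
Lemma exp_lead_mul_coef n b f g : (forall i, stab g`_i) ->
    (size f <= n)%N -> (size g <= b.+1)%N -> (forall i, N (f * g)`_i) ->
  forall i, N (g`_b ^+ n * f`_i).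
Proof.
move=> sg + szg; elim: n f => [|n IHn] f szf Nfg i.
  by move: szf; rewrite size_poly_leq0 => /eqP ->; rewrite coef0 mulr0.
set c := g`_b.
have Ncf : N (c * f`_n).
  suff -> : c * f`_n = (f * g)`_(n + b) by [].
  have nlt : (n < (n + b).+1)%N by rewrite ltnS leq_addr.
  rewrite coefM (bigD1 (Ordinal nlt)) //= addKn big1 ?addr0 1?mulrC // => j.
  rewrite -val_eqE /=; case: (ltngtP (j : nat) n) => // jn _.
    by rewrite (nth_default 0 (s := g)) ?mulr0 // (leq_trans szg) // ltn_subRL ltn_add2r.
  by rewrite (nth_default 0 (leq_trans szf jn)) mul0r.
pose f1 := c *: f - (c * f`_n) *: 'X^n.
have szf1 : (size f1 <= n)%N.
  apply/leq_sizeP => j; rewrite leq_eqVlt coefB !coefZ coefXn => /predU1P[<-|nj].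
    by rewrite eqxx mulr1 subrr.
  by rewrite gtn_eqF // mulr0 subr0 (nth_default 0 (leq_trans szf nj)) mulr0.
have Nf1g j : N (f1 * g)`_j.
  rewrite mulrBl coefB -!scalerAl !coefZ; apply: NB; first exact: sg.
  by rewrite coefXnM; case: ifP => _; rewrite ?mulr0 // mulrC; apply: sg.
have := IHn _ szf1 Nf1g i.
rewrite coefB !coefZ coefXn mulrBr mulrA -exprSr => /ND; rewrite -/c.
move=> /(_ (c ^+ n * (c * f`_n * (i == n)%:R))); rewrite subrK; apply.
by apply: stabX; [exact: sg | case: eqP => _; rewrite ?mulr1 ?mulr0].
Qed.

(* Peeling off the top coefficient [c] of [g]: once [c *: f] has coefficients in
   [N], so has the product of [f] with the rest of [g]. *)
Lemma mul_coef_descent (Z : T -> Prop) g : (forall i, stab g`_i) ->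
    (forall f, (forall z, Z z -> forall i, N (z * f`_i)) ->
       (forall j i, N (g`_j * f`_i)) -> forall i, N f`_i) ->
  forall f, (forall z, Z z -> forall i, N (z * f`_i)) ->
    (forall i, N (f * g)`_i) -> forall i, N f`_i.
Proof.
have [b] := ubnP (size g); elim: b Z g => // b IHb Z g.
rewrite ltnS => szg sg H f.
have [n] := ubnP (size f) => /ltnW szf Zf Nfg i.
case: b szg IHb => [|b] szg IHb.
  apply: H => // j k; move: szg; rewrite size_poly_leq0 => /eqP ->.
  by rewrite coef0 mul0r.
set c := g`_b.
(* Descent on the exponent: if [c ^+ e.+1] sends [f] into [N], the induction hypothesis applied to
   [c *: f] shows that [c] already does. *)
suff: forall e f, (forall z, Z z -> forall i, N (z * f`_i)) ->
    (forall i, N (f * g)`_i) -> (forall i, N (c ^+ e * f`_i)) ->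
    forall i, N f`_i.
  by apply; [exact: Zf | exact: Nfg | exact: exp_lead_mul_coef szf szg Nfg].
elim=> {n f szf Zf Nfg i} [|e IHe] f Zf Nfg Ncf i.
  by have := Ncf i; rewrite mul1r.
have Ncf' : forall i, N (c * f`_i).
  move=> k; rewrite -coefZ; apply: IHe => {k}.
  - by move=> z Zz k; rewrite coefZ mulrCA; apply/sg/Zf.
  - by move=> k; rewrite -scalerAl coefZ; apply: sg.
  - by move=> k; rewrite coefZ mulrA -exprSr.
pose g1 := g - c *: 'X^b.
have g1E j : g1`_j = if j == b then 0 else g`_j.
  by rewrite coefB coefZ coefXn; case: eqP => [->|]; rewrite ?mulr1 ?mulr0 ?subrr ?subr0.
(* [c] joins the multipliers [Z]; this restores the products with the coefficient dropped from [g]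
   when [H] is called. *)
apply: (IHb (fun z => Z z \/ z = c) g1).
- rewrite ltnS; apply/leq_sizeP => j; rewrite g1E leq_eqVlt => /predU1P[<-|bj].
    by rewrite eqxx.
  by rewrite gtn_eqF //; move/leq_sizeP: szg; apply.
- by move=> j x Nx; rewrite g1E; case: eqP => _; [rewrite mul0r | apply: sg].
- move=> f' Zf' g1f'; apply: H => [z Zz|j k]; first by apply: Zf'; left.
  have := g1f' j k; rewrite g1E; case: eqP => // -> _.
  by apply: Zf'; right.
- by move=> z [Zz|->]; [exact: Zf | exact: Ncf'].
- move=> k; rewrite mulrBr coefB; apply: NB => //.
  by rewrite -scalerAr coefZ coefMXn; case: ifP => // _; rewrite mulr0.
Qed.

(** The descent starts with no known multiplier. At its end every [g]_j * f[_i] lies in [N], and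
    expanding [1 = (g * q)]_m[writes]f[_i] as a combination of these. *)
Lemma unit_content_mul_coef f g q m :
    (forall i, stab g`_i) -> (forall i, stab q`_i) ->
    (g * q)`_m = 1 -> (forall i, N (f * g)`_i) ->
  forall i, N f`_i.
Proof.
move=> sg sq gq1 Nfg.
apply: (mul_coef_descent (Z := fun _ => False) sg) => // {Nfg}f _ Ngf i.
rewrite -[f`_i]mul1r -gq1 coefM mulr_suml; elim/big_ind: _ => // j _.
by rewrite mulrAC mulrC; apply: sq.
Qed.

End UnitContent.

(** * Polynomials of unit content over a commutative ring *)

(* [1] is a coefficient of [p * q] for some [q] iff the coefficients of [p]
   generate the unit ideal. *)
Definition unit_content (T : comNzRingType) (p : {poly T}) : Prop :=
  exists q m, (p * q)`_m = 1.

Lemma coefM_poly_rev (T : comNzRingType) (p : {poly T}) (a : nat -> T) :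
  (p * \poly_(i < (size p).+1) a (size p - i)%N)`_(size p) =
    \sum_(i < size p) a i * p`_i.
Proof.
rewrite coefM big_ord_recr /= nth_default // mul0r addr0; apply: eq_bigr => i _.
by rewrite coef_poly ltnS leq_subr subKn 1?mulrC // ltnW.
Qed.

Lemma coefM_size (T : comNzRingType) (p q : {poly T}) m :
  (p * q)`_m = \sum_(i < size p) (if (i <= m)%N then q`_(m - i) else 0) * p`_i.
Proof.
rewrite coefM.
rewrite (big_ord_widen (size p + m.+1) (fun i => p`_i * q`_(m - i))) ?leq_addl //.
rewrite (big_ord_widen (size p + m.+1)
  (fun i => (if (i <= m)%N then q`_(m - i) else 0) * p`_i)) ?leq_addr //.
rewrite [LHS]big_mkcond [RHS]big_mkcond; apply: eq_bigr => i _; rewrite ltnS.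
case: ifP => _; case: ltnP => [//|pi]; rewrite ?mul0r 1?mulrC //.
by rewrite (nth_default 0 pi) mulr0.
Qed.

(** Gauss's lemma: cancelling [g] puts the coefficients of [f], hence [1], in the ideal generated by
    the coefficients of [f * g]. *)
Lemma unit_contentM (T : comNzRingType) (f g : {poly T}) :
  unit_content f -> unit_content g -> unit_content (f * g).
Proof.
move=> [p [k fp1]] [q [m gq1]].
(* This is that ideal, each element being a single coefficient of a multiple of [f * g]. *)
pose N x := exists q m, x = (f * g * q)`_m.
have N0 : N 0 by exists 0, 0; rewrite mulr0 coef0.
have NB x y : N x -> N y -> N (x - y).
  (* Shifting the cofactors brings both coefficients to degree [i + j]. *)
  move=> [u [i ->]] [v [j ->]]; exists (u * 'X^j - v * 'X^i), (i + j)%N.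
  rewrite mulrBr !mulrA coefB !coefMXn ltnNge leq_addl addnK.
  by rewrite ltnNge leq_addr /= addKn.
have NM a x : N x -> N (a * x).
  by move=> [u [i ->]]; exists (a *: u), i; rewrite -scalerAr coefZ.
have Nf : forall i, N f`_i.
  apply: (unit_content_mul_coef N0 NB (g := g) _ _ gq1) => i.
  - exact: NM.
  - exact: NM.
  - by exists 1, i; rewrite mulr1.
suff [u [i ui]] : N 1 by exists u, i.
rewrite -fp1 coefM; elim/big_ind: _ => // [x y Nx Ny|i _].
  by rewrite -[y]opprK -[- y]sub0r; do 2!apply: (NB) => //.
by rewrite mulrC; apply: NM.
Qed.

(** * The universal splitting ring of a monic polynomial *)

Definition reflects_unit_content (R S : comNzRingType) (phi : R -> S) : Prop :=
  forall p : {poly R}, unit_content (map_poly phi p) -> unit_content p.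

(** Taking the constant coefficient of the reduced representative is an [R]-linear retraction of
    [qpolyC h]; it carries a cofactor of [p] over the quotient to one over [R]. *)
Lemma qpolyC_reflects_unit_content (R : comNzRingType) (h : {poly R}) :
  reflects_unit_content (qpolyC h).
Proof.
move=> p [q [m pq1]].
exists (\poly_(i < m.+1) (q`_i : {poly R})`_0), m.
have := congr1 (fun x : {poly %/ h} => (x : {poly R})`_0) pq1.
rewrite /= coefM coefn_sum coefC /= => <-; rewrite coefM; apply: eq_bigr => i _.
rewrite coef_poly ltnS leq_subr coef_map /=.
rewrite -[RHS]/((rmodp ((p`_i)%:P * (q`_(m - i) : {poly R})) (mk_monic h))`_0).
rewrite mul_polyC rmodpZ ?monic_mk_monic //.
by rewrite coefZ rmodp_small ?size_mk_monic.
Qed.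

Lemma qpolyX_root (R : comNzRingType) (h : {poly R}) :
  h \is monic -> (1 < size h)%N -> root (map_poly (qpolyC h) h) 'qX.
Proof.
move=> hm sh.
have XE n : in_qpoly h 'X ^+ n = in_qpoly h 'X^n by rewrite rmorphXn.
rewrite /root horner_coef size_map_poly_id0; last first.
  by rewrite (monicP hm) rmorph1 oner_neq0.
under eq_bigr => i _.
  rewrite coef_map /= XE.
  have -> : qpolyC h h`_i = in_qpoly h (h`_i)%:P.
    apply/val_inj; rewrite /= rmodp_small // size_polyC.
    by rewrite (leq_ltn_trans _ (size_mk_monic_gt1 h)) //; case: eqP.
  rewrite -in_qpolyM mul_polyC.
  over.
rewrite -raddf_sum /= -poly_def; apply/eqP/val_inj => /=.
by rewrite coefK /mk_monic sh hm rmodpp.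
Qed.

(** Adjoin the class of ['X] modulo [r], divide by the resulting linear factor, and repeat with the
    monic quotient, whose degree is one less. *)
Lemma universal_splitting d (R : comNzRingType) (r : {poly R}) :
    r \is monic -> size r = d.+1 ->
  exists (S : comNzRingType) (phi : {rmorphism R -> S}) (rs : seq S),
    map_poly phi r = \prod_(x <- rs) ('X - x%:P) /\ reflects_unit_content phi.
Proof.
elim: d R r => [|d IHd] R r rm szr.
  exists R, idfun, [::]; rewrite big_nil map_poly_id //; split.
    have /size_poly1P[c _ rE] : size r == 1 by rewrite szr.
    by move/monicP: rm; rewrite rE lead_coefC => ->.
  by move=> p; rewrite map_poly_id.
have /factor_theorem[q qE] : root (map_poly (qpolyC r) r) 'qX.
  by apply: qpolyX_root => //; rewrite szr.
have mr : map_poly (qpolyC r) r \is monic by apply: monic_map.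
have mq : q \is monic by move: mr; rewrite qE monicMr // monicXsubC.
have szq : size q = d.+1.
  have := size_map_poly_id0 (f := qpolyC r) (p := r).
  rewrite (monicP rm) rmorph1 oner_neq0 => /(_ isT).
  rewrite qE size_Mmonic ?monicXsubC ?monic_neq0 // size_XsubC szr addn2.
  by case.
have [S [phi [rs [phiq phi_refl]]]] := IHd _ q mq szq.
exists S, (phi \o qpolyC r), (rcons rs (phi 'qX)); split.
  rewrite map_poly_comp qE rmorphM /= phiq big_rcons /=.
  by rewrite rmorphB /= map_polyX map_polyC.
by move=> p; rewrite map_poly_comp => /phi_refl/qpolyC_reflects_unit_content.
Qed.

(** * Products of conjugates through symmetric polynomials *)

Lemma mmap_mesym d (R S : comNzRingType) (f : {rmorphism R -> S})
    (alpha : 'I_d -> S) k :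
  mmap f alpha (mesym d R k) =
    \sum_(h : {set 'I_d} | #|h| == k) \prod_(i in h) alpha i.
Proof.
rewrite rmorph_sum; apply: eq_bigr => h _.
by rewrite rmorph_prod; apply: eq_bigr => i _; rewrite /= mmapX mmap1U.
Qed.

Lemma coef_prod_XsubC (S : comNzRingType) d (alpha : 'I_d -> S) k :
  (k <= d)%N ->
  (\prod_(i < d) ('X - (alpha i)%:P))`_(d - k) =
    (-1) ^+ k * \sum_(h : {set 'I_d} | #|h| == k) \prod_(i in h) alpha i.
Proof.
move=> kd; pose f := mmap intr alpha : {mpoly int[d]} -> S.
have := congr1 (map_poly f) (Viete d); rewrite rmorph_prod /=.
under eq_bigr => i _ do rewrite rmorphB /= map_polyX map_polyC /= mmapX mmap1U.
have kd1 : (k < d.+1)%N by [].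
move=> ->; rewrite raddf_sum coef_sum (bigD1 (Ordinal kd1)) //= big1 => [|j jk].
  rewrite addr0 !map_polyZ /= map_polyXn !coefZ coefXn eqxx mulr1.
  by rewrite rmorphXn rmorphN1 /f mmap_mesym.
rewrite !map_polyZ /= map_polyXn !coefZ coefXn; case: eqP => [djk|]; rewrite ?mulr0 //.
have jd : (j <= d)%N by rewrite -ltnS.
by case/eqP: jk; apply: val_inj; rewrite /= -(subKn jd) -djk subKn.
Qed.

Lemma mmap_comp_mpoly n k (R S : comNzRingType) (f : {rmorphism R -> S})
    (h : 'I_k -> S) (p : {mpoly R[n]}) (lp : n.-tuple {mpoly R[k]}) :
  mmap f h (p \mPo lp) = mmap f (fun i => mmap f h (tnth lp i)) p.
Proof.
rewrite /comp_mpoly [X in mmap f h X]/mmap rmorph_sum [RHS]/mmap.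
apply: eq_bigr => m _; rewrite rmorphM /= mmapC /mmap1 rmorph_prod.
by congr (_ * _); apply: eq_bigr => i _; rewrite rmorphXn.
Qed.

(** The product is symmetric in the roots, hence a polynomial in the coefficients of [r]. [G] is
    fixed before [S], so that one [G] can be examined in different splitting rings. *)
Lemma conjugate_product (R : comNzRingType) (r : {poly R}) n k d :
  exists G : {poly R},
    forall (S : comNzRingType) (phi : {rmorphism R -> S}) (alpha : 'I_d -> S),
      map_poly phi r = \prod_(i < d) ('X - (alpha i)%:P) ->
    map_poly phi G = \prod_(tau : {ffun 'I_k -> 'I_d})
      \sum_(i < k) (if i == n :> nat then 1 else alpha (tau i)) *: 'X^i.
Proof.
(* A generic conjugate: the roots are indeterminates, and the polynomial variable is moved into the
   coefficient ring [{poly R}]. *)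
pose F (T : {ffun 'I_k -> 'I_d}) : {mpoly {poly R}[d]} :=
  \sum_(i < k) ('X^i)%:MP * (if i == n :> nat then 1 else 'X_(T i)).
have : (\prod_(T : {ffun 'I_k -> 'I_d}) F T) \is symmetric.
  apply/issymP => s; rewrite rmorph_prod /=.
  (* Permuting the indeterminates only permutes the index functions [T], hence the factors. *)
  pose act (u : 'S_d) (T : {ffun 'I_k -> 'I_d}) := [ffun i => u (T i)].
  have actK : cancel (act s^-1%g) (act s).
    by move=> T; apply/ffunP => i; rewrite !ffunE permKV.
  have actKV : cancel (act s) (act s^-1%g).
    by move=> T; apply/ffunP => i; rewrite !ffunE permK.
  rewrite [RHS](reindex (act s)) /=; last by exists (act s^-1%g) => ? _.
  apply: eq_bigr => T _; rewrite rmorph_sum; apply: eq_bigr => i _.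
  rewrite rmorphM /= [X in X * _]mmapC; congr (_ * _).
  by case: eqP => _; rewrite ?rmorph1 // /msym mmapX mmap1U ffunE.
case/sym_fundamental=> t [tE _].
(* By Viete, the image of [c i] is the elementary symmetric function of degree [i.+1] of the
   roots. *)
pose c i := (-1) ^+ i.+1 * r`_(d - i.+1).
exists (mmap idfun (fun i : 'I_d => (c i)%:P) t) => S phi alpha phir.
have GE : map_poly phi (mmap idfun (fun i : 'I_d => (c i)%:P) t) =
    mmap (map_poly phi) (fun i : 'I_d => mmap (map_poly phi) (fun j => (alpha j)%:P)
      (tnth [tuple mesym d {poly R} i.+1 | i < d] i)) t.
  rewrite [X in map_poly phi X]/mmap rmorph_sum [RHS]/mmap; apply: eq_bigr => m _.
  rewrite rmorphM /= /mmap1 rmorph_prod; congr (_ * _).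
  apply: eq_bigr => i _; rewrite rmorphXn; congr (_ ^+ _).
  rewrite tnth_mktuple /= map_polyC /= /c.
  rewrite rmorphM rmorphXn rmorphN1 -coef_map phir.
  rewrite coef_prod_XsubC // mulrA -expr2 -exprM mulnC exprM.
  rewrite sqrrN !expr1n mul1r mmap_mesym rmorph_sum; apply: eq_bigr => h _.
  by rewrite rmorph_prod.
rewrite GE -mmap_comp_mpoly tE rmorph_prod; apply: eq_bigr => T _.
rewrite rmorph_sum; apply: eq_bigr => i _.
rewrite rmorphM /= mmapC /= map_polyXn mulrC; case: eqP => _.
  by rewrite rmorph1 scale1r mul1r.
by rewrite mmapX mmap1U mul_polyC.
Qed.

(** * Multiples of unit content of an integral polynomial *)

(** The remainder of [p] by [q] becomes a multiple of [q] over [S]. Although [S] may have zero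
    divisors, the leading coefficient of [q] maps to a unit, so comparing degrees makes the
    remainder vanish. *)
Lemma dvdp_map_ring (K : fieldType) (S : comNzRingType) (phi : {rmorphism K -> S})
    (p q : {poly K}) (w : {poly S}) :
  q != 0 -> map_poly phi p = map_poly phi q * w -> (q %| p)%R.
Proof.
move=> q0 pqw.
have rE : map_poly phi (p %% q) = map_poly phi q * (w - map_poly phi (p %/ q)).
  rewrite mulrBr -pqw {2}(divp_eq p q) rmorphD rmorphM /= [_ * map_poly phi q]mulrC.
  by rewrite addrC addKr.
set u := w - _ in rE.
have := ltn_modp p q; rewrite q0 -(size_map_poly phi) -(size_map_poly phi q) rE.
have [u0|u0] := eqVneq u 0.
  by move=> _; rewrite /dvdp -(map_poly_eq0 phi) rE u0 mulr0.
rewrite size_proper_mul.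
  have : (0 < size u)%N by rewrite size_poly_gt0.
  by case: (size _) => // m _; rewrite addnS /= ltnNge leq_addr.
rewrite lead_coef_map; apply: contra_neq u0 => cu0; apply/eqP.
rewrite -lead_coef_eq0 -[lead_coef _]mul1r -(rmorph1 phi).
by rewrite -(@mulVf _ (lead_coef q)) ?lead_coef_eq0 // rmorphM -mulrA cu0 mulr0.
Qed.

(* The multiple is the product of all "conjugates" of [Q], obtained by replacing
   each coefficient other than [Q`_n] by each root of a common integral
   equation. *)
Lemma integral_poly_dvd_unit_content (R : comNzRingType) (K : fieldType)
    (iota : {rmorphism R -> K}) (Q : {poly K}) n :
    (forall i, integralOver iota Q`_i) -> Q`_n = 1 ->
  exists2 G : {poly R}, (Q %| map_poly iota G)%R & unit_content G.
Proof.
move=> Qint Qn1; pose k := size Q.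
have nk : (n < k)%N.
  by rewrite ltnNge; apply/negP => /(nth_default 0)/eqP; rewrite Qn1 oner_eq0.
have Q0 : Q != 0 by rewrite -size_poly_gt0 (leq_ltn_trans _ nk).
have rP (i : 'I_k) : exists r : {poly R}, exists q : {poly K},
    r \is monic /\ map_poly iota r = q * ('X - (Q`_i)%:P).
  by have [r rm /factor_theorem[q rE]] := Qint i; exists r, q.
have /boolp.choice[r {}rP] := rP; have /boolp.choice[q {}rP] := rP.
have qm i : q i \is monic.
  have [rm rE] := rP i; have := monic_map iota rm.
  by rewrite rE monicMr ?monicXsubC.
have prm : \prod_i r i \is monic by apply: monic_prod => i _; case: (rP i).
pose pq := \prod_i q i; pose d := (size (\prod_i r i)).-1.
have prE : map_poly iota (\prod_i r i) = \prod_(i < k) ('X - (Q`_i)%:P) * pq.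
  rewrite rmorph_prod -big_split; apply: eq_bigr => i _ /=.
  by rewrite mulrC; case: (rP i).
have szpr : size (map_poly iota (\prod_i r i)) = d.+1.
  rewrite size_map_poly_id0 ?(monicP prm) ?rmorph1 ?oner_neq0 //.
  by rewrite prednK // size_poly_gt0 monic_neq0.
have [G GP] := conjugate_product (\prod_i r i) n k d.
exists G.
- have szpq : size pq = (size pq).-1.+1.
    by rewrite prednK // size_poly_gt0 monic_neq0 // monic_prod.
  have pqm : pq \is monic by apply: monic_prod.
  (* Only the cofactor [pq] is split: the coefficients of [Q] are roots in [K] already and come
     first in the list [ss]. *)
  have [S [phi [rs [pqE _]]]] := universal_splitting pqm szpq.
  pose ss := [seq phi Q`_i | i <- index_iota 0 k] ++ rs.
  have ssE : map_poly (phi \o iota) (\prod_i r i) = \prod_(x <- ss) ('X - x%:P).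
    rewrite map_poly_comp prE rmorphM /= pqE big_cat big_map big_mkord.
    congr (_ * _); rewrite rmorph_prod; apply: eq_bigr => i _.
    by rewrite rmorphB /= map_polyX map_polyC.
  have szss : size ss = d.
    by have := size_prod_XsubC ss id; rewrite -ssE map_poly_comp size_map_poly szpr => -[].
  have kd : (k <= d)%N by rewrite -szss size_cat size_map size_iota subn0 leq_addr.
  have := GP _ (phi \o iota) (fun i => ss`_i).
  rewrite ssE (big_nth 0) szss big_mkord => /(_ erefl).
  (* The factor for this inclusion of indices is the image of [Q] itself. *)
  rewrite (bigD1 [ffun i => widen_ord kd i]) //= map_poly_comp.
  set w := (X in _ * X) => /esym GE; apply: (dvdp_map_ring (phi := phi) (w := w) Q0).
  rewrite -GE; congr (_ * _).
  rewrite -[in RHS](coefK Q) poly_def rmorph_sum /=.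
  apply: eq_bigr => i _; rewrite map_polyZ map_polyXn ffunE /=.
  rewrite nth_cat size_map size_iota subn0 ltn_ord.
  rewrite (nth_map 0) ?size_iota ?subn0 // nth_iota ?subn0 // add0n.
  by case: eqP => // ->; rewrite Qn1 rmorph1.
have szr : size (\prod_i r i) = d.+1.
  by rewrite prednK // size_poly_gt0 monic_neq0.
(* A second splitting, now over [R]: each factor has coefficient [1] in degree [n], so the image of
   [G] has unit content, and this is reflected to [R]. *)
have [S [phi [rs [rE]]]] := universal_splitting prm szr; apply.
have szrs : size rs = d.
  have := size_prod_XsubC rs id; rewrite -rE size_map_poly_id0 ?szr; last first.
    by rewrite (monicP prm) rmorph1 oner_neq0.
  by case.
have := GP _ phi (fun i => rs`_i).
rewrite rE (big_nth 0) szrs big_mkord => /(_ erefl) ->.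
elim/big_ind: _ => [||T _]; first by exists 1, 0; rewrite mulr1 coef1.
  exact: unit_contentM.
exists 1, n; rewrite mulr1 coef_sum (bigD1 (Ordinal nk)) //= eqxx scale1r coefXn.
rewrite eqxx big1 ?addr0 // => i; rewrite -val_eqE /= eq_sym => /negPf ni.
by rewrite coefZ coefXn ni mulr0.
Qed.

(** * Nagata rings of subrings of a field *)

Section Nagata.
Variable K : fieldType.
Implicit Types (A J : set K) (f g : {poly K}).

Lemma subring0 A : is_subring A -> A 0.
Proof. by move=> [A1 AB _]; rewrite -(subrr 1); apply: AB. Qed.

Lemma subringN A x : is_subring A -> A x -> A (- x).
Proof.
by move=> sA Ax; rewrite -sub0r; case: (sA) => _ + _; apply=> //; apply: subring0.
Qed.

Lemma subringD A x y : is_subring A -> A x -> A y -> A (x + y).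
Proof.
by move=> sA Ax Ay; rewrite -[y]opprK; case: (sA) => _ + _; apply=> //; apply: subringN.
Qed.

Lemma poly_overM A f g :
  is_subring A -> poly_over A f -> poly_over A g -> poly_over A (f * g).
Proof.
move=> sA Af Ag i; rewrite coefM; elim/big_ind: _ => [|x y|j _].
- exact: subring0.
- exact: subringD.
- by case: (sA) => _ _; apply.
Qed.

Lemma content_eq A g : is_subring A -> poly_over A g -> content A g = A ->
  exists q m, poly_over A q /\ (g * q)`_m = 1.
Proof.
move=> sA Ag cg; have [A1 _ _] := sA; move: A1; rewrite -{1}cg => -[a Aa a1].
exists (\poly_(i < (size g).+1) a (size g - i)%N), (size g).
split; last by rewrite coefM_poly_rev -a1.
by move=> i; rewrite coef_poly; case: ifP => // _; apply: subring0.
Qed.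

Lemma eq_content A g q m : is_subring A -> poly_over A g -> poly_over A q ->
  (g * q)`_m = 1 -> content A g = A.
Proof.
move=> sA Ag Aq gq1; have A0 := subring0 sA; apply/seteqP; split=> x.
  move=> [a Aa ->]; elim/big_ind: _ => [//|y z|i _]; first exact: subringD.
  by case: (sA) => _ _; apply.
move=> Ax; exists (fun i => x * (if (i <= m)%N then q`_(m - i) else 0)).
  by move=> i; case: (sA) => _ _; apply=> //; case: ifP.
by rewrite -[LHS]mulr1 -gq1 coefM_size mulr_sumr; apply: eq_bigr => i _; rewrite mulrA.
Qed.

Lemma nagata_subset A B :
  is_subring A -> is_subring B -> A `<=` B -> nagata A `<=` nagata B.
Proof.
move=> sA sB AB h [f [g [Af Ag cg ->]]]; exists f, g; split=> //.
- by move=> i; apply/AB/Af.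
- by move=> i; apply/AB/Ag.
have [q [m [Aq gq1]]] := content_eq sA Ag cg.
by apply: eq_content gq1 => // i; apply/AB.
Qed.

(** Writing the fraction as [f' / g'] with [g'] of unit content gives [f * g' = f' * g] over [A];
    then [g'] is cancelled with [N := A]. *)
Lemma nagata_poly A f g : is_subring A -> poly_over A g -> g != 0 ->
  nagata A (tofrac f / tofrac g) -> poly_over A f.
Proof.
move=> sA Ag g0 [f' [g' [Af' Ag' cg' fgE]]].
have [q [m [Aq gq1]]] := content_eq sA Ag' cg'.
have g'0 : g' != 0.
  by apply: contra_eq_neq gq1 => ->; rewrite mul0r coef0 eq_sym oner_neq0.
have fg : f * g' = f' * g.
  apply/eqP; rewrite -tofrac_eq !tofracM.
  by rewrite -eqr_div ?tofrac_eq0 // fgE.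
have [_ AB AM] := sA.
apply: (unit_content_mul_coef (N := A) (subring0 sA) AB (g := g') _ _ gq1).
- by move=> i x; apply: AM.
- by move=> i x; apply: AM.
- by rewrite fg; apply: poly_overM.
Qed.

End Nagata.

(** * Fractions over [D] with a denominator of unit content *)

Lemma in_frac_subring (D : idomainType) : is_subring (in_frac D).
Proof.
split; first by exists 1; rewrite ?tofrac1.
- by move=> _ _ [x _ <-] [y _ <-]; exists (x - y); rewrite ?tofracB.
- by move=> _ _ [x _ <-] [y _ <-]; exists (x * y); rewrite ?tofracM.
Qed.

Lemma fractionP (D : idomainType) (x : {fraction D}) :
  exists a b : D, b != 0 /\ x = tofrac a / tofrac b.
Proof.
elim/quotW: x => x; exists (\n_x), (\d_x); split; first exact: denom_ratioP.
have d0 : tofrac (\d_x) != 0 by rewrite tofrac_eq0 denom_ratioP.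
apply/(mulIf d0); rewrite divfK //; unlock FracField.tofrac.
rewrite -[LHS]FracField.pi_mul; apply/eqmodP/eqP.
rewrite /= /FracField.mulf !numden_Ratio ?mulf_neq0 ?oner_eq0 ?denom_ratioP //.
by rewrite !mulr1 mulrC.
Qed.

Lemma common_denominator (D : idomainType) (p : {poly {fraction D}}) :
  exists2 d : D, d != 0 & poly_over (in_frac D) (tofrac d *: p).
Proof.
have /boolp.choice[a /boolp.choice[b ab]] := fun i => fractionP p`_i.
exists (\prod_(i < size p) b i).
  by apply/prodf_neq0 => i _; case: (ab i).
move=> i; rewrite coefZ; case: (ltnP i (size p)) => [ip|pi]; last first.
  rewrite nth_default // mulr0; exact: (subring0 (in_frac_subring D)).
have [bi0 ->] := ab i.
exists (a i * \prod_(j < size p | j != Ordinal ip) b j) => //.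
by rewrite [in RHS](bigD1 (Ordinal ip)) //= !tofracM [X in X * (_ / _)]mulrC mulrACA
  divff ?tofrac_eq0 // mulr1 mulrC.
Qed.

(* With [1 = \sum_i b_i * c_i], where the [b_i] are the coefficients of [q] and
   the [c_i] lie in the inverse of its content, reversing the order of the [c_i]
   makes [1] appear as a coefficient of the product. *)
Lemma prufer_unit_coef (K : fieldType) (B : set K) (q : {poly K}) :
    is_subring B -> is_prufer B -> q != 0 -> poly_over B q ->
  exists q' n, poly_over B (q * q') /\ (q * q')`_n = 1.
Proof.
move=> sB prB q0 Bq; have B0 := subring0 sB; have [B1 _ BM] := sB.
have qI i : ideal_gen B q q`_i.
  have [qi|iq] := leqP (size q) i.
    exists (fun=> 0) => //; rewrite nth_default // big1 // => j _.
    by rewrite mul0r.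
  exists (fun j => (j == i)%:R); first by move=> j; case: eqP.
  rewrite (bigD1 (Ordinal iq)) //= eqxx mul1r big1 ?addr0 // => j.
  by rewrite -val_eqE /= => /negPf ->; rewrite mul0r.
have [||J [J0 JD JZ] IJB] := prB q.
- by move=> _ /(nthP 0)[i _ <-].
- move=> I0; have := qI (size q).-1; rewrite I0 /= => /eqP.
  by rewrite lead_coef_eq0 (negPf q0).
have qJ i c : J c -> B (q`_i * c).
  move=> Jc; rewrite -IJB; exists [:: (q`_i, c)]; last by rewrite big_seq1.
  by move=> _ /[1!inE] /eqP ->; split=> /=; [apply: qI|].
have [c Jc c1] : exists2 c : nat -> K,
    (forall i, J (c i)) & 1 = \sum_(i < size q) c i * q`_i.
  move: B1; rewrite -IJB => -[t tP ->]; elim: t tP => [|[x y] t IHt] tP.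
    by exists (fun=> 0) => //; rewrite big_nil big1 // => i _; rewrite mul0r.
  have [|c Jc cE] := IHt; first by move=> p pt; apply: tP; rewrite inE pt orbT.
  have [/= [a Ba ->] Jy] := tP (x, y) (mem_head _ _).
  exists (fun i => a i * y + c i); first by move=> i; apply/JD/Jc/JZ.
  rewrite big_cons cE /= mulr_suml -big_split; apply: eq_bigr => i _ /=.
  by rewrite mulrDl mulrAC.
exists (\poly_(i < (size q).+1) c (size q - i)%N), (size q).
split; last by rewrite coefM_poly_rev -c1.
move=> i; rewrite coefM; elim/big_ind: _ => [//|x y|j _]; first exact: subringD.
by rewrite coef_poly; case: ifP => _; [apply: qJ | rewrite mulr0].
Qed.

Lemma integral_closure_subring (D : idomainType) : is_subring (integral_closure D).
Proof.
split; first exact: integral1.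
- by move=> x y; apply: integral_sub.
- by move=> x y; apply: integral_mul.
Qed.

Lemma unit_content_denominator (D : idomainType) (h : {fraction {poly {fraction D}}}) :
    is_prufer (integral_closure D) ->
  exists f g, [/\ poly_over (in_frac D) g, content (in_frac D) g = in_frac D
    & h = tofrac f / tofrac g].
Proof.
move=> prufer; have sD := in_frac_subring D.
have [p [q [q0 ->]]] := fractionP h.
have [d d0 Dq] := common_denominator q.
have dF0 : tofrac d != 0 by rewrite tofrac_eq0.
have dq0 : tofrac d *: q != 0 by rewrite scaler_eq0 negb_or dF0.
have Bdq : poly_over (integral_closure D) (tofrac d *: q).
  by move=> i; have [x _ <-] := Dq i; apply: integral_id.
have [q' [n [Bqq' qq'1]]] :=
  prufer_unit_coef (integral_closure_subring D) prufer dq0 Bdq.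
have [G qG [u [m Gu1]]] := integral_poly_dvd_unit_content Bqq' qq'1.
(* The nonzero constant [tofrac d] does not affect divisibility over the field, so [q] itself
   divides the image of [G]. *)
have /dvdpP[w wE] : q %| map_poly (@tofrac D) G.
  by apply: dvdp_trans qG; rewrite -scalerAl dvdpZr // dvdp_mulr.
pose g := map_poly (@tofrac D) G.
have Dmap (r : {poly D}) : poly_over (in_frac D) (map_poly (@tofrac D) r).
  by move=> i; rewrite coef_map; exists r`_i.
have cg : (g * map_poly (@tofrac D) u)`_m = 1.
  by rewrite -rmorphM coef_map Gu1 /= tofrac1.
have g0 : g != 0.
  by apply: contra_eq_neq cg => ->; rewrite mul0r coef0 eq_sym oner_neq0.
exists (p * w), g; split; [exact: Dmap | exact: eq_content sD (Dmap G) (Dmap u) cg|].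
have w0 : w != 0 by apply: contraNneq g0 => w0; rewrite /g wE w0 mul0r.
by rewrite /g wE [w * q]mulrC !tofracM -mulf_div divff ?tofrac_eq0 // mulr1.
Qed.

Theorem theorem4p6 (D : idomainType) (s : nat)
    (prufer : is_prufer (integral_closure D))
    (findim : finite_krull_dim (integral_closure D))
    (semilocal : maximal_ideals (integral_closure D) #= `I_s)
    (residue : forall M : set {fraction D}, maximal_ideal (in_frac D) M ->
       `I_s #<= residue_field (in_frac D) M)
    (F : set (set {fraction D}))
    (F_local : forall A : set {fraction D}, F A -> overring A /\ is_local A)
    (F_cap : \bigcap_(A in F) A = in_frac D) :
  \bigcap_(A in F) nagata A = nagata (in_frac D).

Proof.
have sD := in_frac_subring D.
have sF A : F A -> is_subring A by move=> /F_local[[]].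
apply/seteqP; split=> h; last first.
  move=> hD A FA; apply: nagata_subset hD => //; first exact: sF.
  by have [[]] := F_local A FA.
(* The fraction [f / g] is chosen before any [A], so the coefficients of this single [f] can be
   tested in every member of [F]. *)
move=> hF; have [f [g [Dg cg hE]]] := unit_content_denominator h prufer.
exists f, g; split=> // i; rewrite -F_cap => A FA.
have DA : in_frac D `<=` A by have [[]] := F_local A FA.
have g0 : g != 0.
  have [q [m [_ gq1]]] := content_eq sD Dg cg.
  by apply: contra_eq_neq gq1 => ->; rewrite mul0r coef0 eq_sym oner_neq0.
apply: (nagata_poly (sF A FA) _ g0) => [j|]; first exact/DA.
by rewrite -hE; apply: hF.
Qed.
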